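(* Let $s\ge 2$ be an integer, and let $G$ be a disconnected minimal $(s,1)$-polar obstruction. Then $G$ satisfies one of the following assertions: (1) $G$ is isomorphic to one of the seven graphs $K_1+2K_2$, $2P_3$, $2K_1+C_4$, $K_1+\overline{P_3+K_2}$, $K_1+C_5$, $K_1+P$, $K_1+\overline{P_5}$. (2) $G\cong 2K_{s+1}$. (3) $G\cong K_2+(2K_1\oplus K_s)$. (4) $G\cong K_1+(C_4\oplus K_{s-1})$.
   Context: All graphs are simple and finite. $G+H$ is disjoint union, $nG$ is the disjoint union of $n$ copies of $G$, $G\oplus H$ is the join $\overline{\overline{G}+\overline{H}}$. $P$ (the banner) is the 5-vertex graph obtained from $C_4$ by attaching one pendant vertex to one vertex of the cycle. For nonnegative integers $s,k$, a graph $G$ is $(s,k)$-polar if its vertex set has a partition $(A,B)$ (parts may be empty) such that $G[A]$ is a complete multipartite graph with at most $s$ parts and $G[B]$ is a disjoint union of at most $k$ complete graphs. A minimal $(s,k)$-polar obstruction is a graph that is not $(s,k)$-polar but all of whose proper induced subgraphs are $(s,k)$-polar. *)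

(* Defs.v *)
From mathcomp Require Import all_boot.
Set Implicit Arguments. Unset Strict Implicit. Unset Printing Implicit Defensive.

Record sgraph := SGraph {
  vertex :> finType;
  adj : rel vertex;
  adj_sym : symmetric adj;
  adj_irr : irreflexive adj
}.

Definition isomorphic (G H : sgraph) : Prop :=
  exists f : G -> H, bijective f /\ forall x y : G, adj (f x) (f y) = adj x y.

Definition connected (G : sgraph) : Prop := forall x y : G, connect (@adj G) x y.

Section Induced.
Variables (G : sgraph) (S : {set G}).
Definition induced_adj (x y : {x : G | x \in S}) : bool := adj (val x) (val y).
Lemma induced_sym : symmetric induced_adj.
Proof. by move=> x y; apply: adj_sym. Qed.
Lemma induced_irr : irreflexive induced_adj.
Proof. by move=> x; apply: adj_irr. Qed.
Definition induced : sgraph := SGraph induced_sym induced_irr.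
End Induced.

Section Complement.
Variable G : sgraph.
Definition compl_adj (x y : G) : bool := (x != y) && ~~ adj x y.
Lemma compl_sym : symmetric compl_adj.
Proof. by move=> x y; rewrite /compl_adj eq_sym adj_sym. Qed.
Lemma compl_irr : irreflexive compl_adj.
Proof. by move=> x; rewrite /compl_adj eqxx. Qed.
Definition compl : sgraph := SGraph compl_sym compl_irr.
End Complement.

Section DisjointUnion.
Variables G H : sgraph.
Definition disj_union_adj (u v : G + H) : bool :=
  match u, v with
  | inl x, inl y => adj x y
  | inr x, inr y => adj x y
  | _, _ => false
  end.
Lemma disj_union_sym : symmetric disj_union_adj.
Proof. by case=> x [] y //=; apply: adj_sym. Qed.
Lemma disj_union_irr : irreflexive disj_union_adj.
Proof. by case=> x /=; apply: adj_irr. Qed.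
Definition disj_union : sgraph := SGraph disj_union_sym disj_union_irr.
End DisjointUnion.

Definition join (G H : sgraph) : sgraph :=
  compl (disj_union (compl G) (compl H)).

Section Copies.
Variables (n : nat) (G : sgraph).
Definition copies_adj (u v : 'I_n * G) : bool := (u.1 == v.1) && adj u.2 v.2.
Lemma copies_sym : symmetric copies_adj.
Proof. by move=> u v; rewrite /copies_adj eq_sym adj_sym. Qed.
Lemma copies_irr : irreflexive copies_adj.
Proof. by move=> u; rewrite /copies_adj adj_irr andbF. Qed.
Definition copies : sgraph := SGraph copies_sym copies_irr.
End Copies.

Section Families.
Variable n : nat.

Definition complete_adj (x y : 'I_n) : bool := x != y.
Lemma complete_sym : symmetric complete_adj.
Proof. by move=> x y; rewrite /complete_adj eq_sym. Qed.
Lemma complete_irr : irreflexive complete_adj.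
Proof. by move=> x; rewrite /complete_adj eqxx. Qed.
Definition complete_graph : sgraph := SGraph complete_sym complete_irr.

Definition path_adj (x y : 'I_n) : bool := (x.+1 == y) || (y.+1 == x).
Lemma path_sym : symmetric path_adj.
Proof. by move=> x y; rewrite /path_adj orbC. Qed.
Lemma path_irr : irreflexive path_adj.
Proof. by move=> x; rewrite /path_adj orbb gtn_eqF. Qed.
Definition path_graph : sgraph := SGraph path_sym path_irr.

(* A cycle only for [3 <= n]; [x != y] excludes the loop at [n = 1]. *)
Definition cycle_adj (x y : 'I_n) : bool :=
  (x != y) && ((x.+1 %% n == y) || (y.+1 %% n == x)).
Lemma cycle_sym : symmetric cycle_adj.
Proof. by move=> x y; rewrite /cycle_adj eq_sym orbC. Qed.
Lemma cycle_irr : irreflexive cycle_adj.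
Proof. by move=> x; rewrite /cycle_adj eqxx. Qed.
Definition cycle_graph : sgraph := SGraph cycle_sym cycle_irr.
End Families.

(* The new vertex is [None]; its only neighbour is [Some v]. *)
Section AddPendant.
Variables (G : sgraph) (v : G).
Definition pendant_adj (x y : option G) : bool :=
  match x, y with
  | Some a, Some b => adj a b
  | Some a, None => a == v
  | None, Some b => b == v
  | None, None => false
  end.
Lemma pendant_sym : symmetric pendant_adj.
Proof. by case=> [a|] [b|] //=; apply: adj_sym. Qed.
Lemma pendant_irr : irreflexive pendant_adj.
Proof. by case=> [a|] //=; apply: adj_irr. Qed.
Definition add_pendant : sgraph := SGraph pendant_sym pendant_irr.
End AddPendant.

Definition banner : sgraph := @add_pendant (cycle_graph 4) (ord0 : 'I_4).

(* [partition] forbids empty blocks, so [#|Q|] is the exact number of parts;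
   the empty graph has [0] parts. *)
Definition complete_multipartite_le (s : nat) (G : sgraph) : Prop :=
  exists Q : {set {set G}},
    [/\ partition Q [set: G], #|Q| <= s
      & forall x y : G, adj x y = (pblock Q x != pblock Q y)].

Definition cluster_le (k : nat) (G : sgraph) : Prop :=
  exists Q : {set {set G}},
    [/\ partition Q [set: G], #|Q| <= k
      & forall x y : G, adj x y = (x != y) && (pblock Q x == pblock Q y)].

Definition polar (s k : nat) (G : sgraph) : Prop :=
  exists A B : {set G},
    [/\ A :|: B = [set: G], [disjoint A & B],
        complete_multipartite_le s (induced A)
      & cluster_le k (induced B)].

Definition minimal_polar_obstruction (s k : nat) (G : sgraph) : Prop :=
  ~ polar s k G /\
  forall S : {set G}, S \proper [set: G] -> polar s k (induced S).

Declare Scope sgraph_scope.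
Delimit Scope sgraph_scope with sg.
Bind Scope sgraph_scope with sgraph.
Notation "G + H" := (disj_union G H) : sgraph_scope.
Notation "G ⊕ H" := (join G H) (at level 50, left associativity) : sgraph_scope.
Notation "G ≅ H" := (isomorphic G%sg H%sg) (at level 70, no associativity).

(* Main.v *)
Require Import Defs.
From mathcomp Require Import all_boot.

(** A graph is [(s,1)]-polar iff deleting some clique leaves a set on which
    non-adjacency is transitive and which has no clique of size [s + 1]. By
    minimality it suffices to embed into every disconnected graph that is not
    [(s,1)]-polar one of the listed graphs, none of which is [(s,1)]-polar.

    Write [G] as two nonempty sides without edges between them. If both sides
    have an edge, then either one side is not complete multipartite, which gives
    [K_1 + 2K_2], or neither is complete, which gives [2P_3], or one side is
    complete and cliques of size [s + 1] give [2K_(s+1)] or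
    [K_2 + (2K_1 ⊕ K_s)].

    Otherwise [G] has an isolated vertex [u], and [H = G - u] is neither split
    nor complete multipartite with at most [s] parts. By the theorem of Foldes
    and Hammer, [H] contains [2K_2], [C_5] or [C_4]. In the last case, if [H] is
    complete multipartite then a clique of size [s + 1] extends the 4-cycle to
    [C_4 ⊕ K_(s-1)]. If not, the complement of [H] contains both [2K_2] and
    [P_3], hence one of [P_3 + K_2], [P_5], the co-banner and the butterfly, the
    latter being the complement of [K_1 + C_4]. *)

Set Implicit Arguments.
Unset Strict Implicit.
Unset Printing Implicit Defensive.

(** * Polarity in terms of vertex sets *)

Lemma adj_neq (X : sgraph) (x y : X) : adj x y -> x != y.
Proof. by apply: contraTneq => ->; rewrite adj_irr. Qed.

Definition clique (X : sgraph) (C : {set X}) :=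
  [forall x in C, forall y in C, (x != y) ==> adj x y].

Definition independent (X : sgraph) (A : {set X}) :=
  [forall x in A, forall y in A, ~~ adj x y].

(* Contrapositive form of the transitivity of non-adjacency on [A]. *)
Definition multipartite (X : sgraph) (A : {set X}) :=
  [forall x in A, forall y in A, forall z in A,
     adj x z ==> adj x y || adj y z].

Definition clique_free (X : sgraph) (k : nat) (A : {set X}) :=
  [forall C : {set X}, (C \subset A) && clique C ==> (#|C| < k)].

Definition split_graph (X : sgraph) :=
  [exists A : {set X}, independent A && clique (~: A)].

Definition polar1 (s : nat) (X : sgraph) :=
  [exists A : {set X},
     [&& multipartite A, clique_free s.+1 A & clique (~: A)]].

Lemma cliqueP (X : sgraph) (C : {set X}) :
  reflect {in C &, forall x y, x != y -> adj x y} (clique C).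
Proof.
apply: (iffP 'forall_in_'forall_in_implyP) => H x.
  by move=> y xC yC; apply: H.
by move=> xC y yC; apply: H.
Qed.

Lemma independentP (X : sgraph) (A : {set X}) :
  reflect {in A &, forall x y, ~~ adj x y} (independent A).
Proof.
apply: (iffP 'forall_in_forall_inP) => H x.
  by move=> y xA yA; apply: H.
by move=> xA y yA; apply: H.
Qed.

Lemma multipartiteP (X : sgraph) (A : {set X}) :
  reflect {in A & &, forall x y z, adj x z -> adj x y || adj y z}
          (multipartite A).
Proof.
apply: (iffP 'forall_in_'forall_in_'forall_in_implyP) => H x.
  by move=> y z xA yA zA; apply: H.
by move=> xA y yA z zA; apply: H.
Qed.

Lemma clique_freeP (X : sgraph) (k : nat) (A : {set X}) :
  reflect (forall C : {set X}, C \subset A -> clique C -> #|C| < k)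
          (clique_free k A).
Proof.
apply: (iffP 'forall_implyP) => H C; first by move=> CA cC; apply: H; rewrite CA.
by case/andP; apply: H.
Qed.

Lemma not_clique (X : sgraph) (C : {set X}) :
  ~~ clique C -> exists x y, [/\ x \in C, y \in C, x != y & ~~ adj x y].
Proof.
case/forall_inPn=> x xC /forall_inPn[y yC]; rewrite negb_imply => /andP[xy nxy].
by exists x, y.
Qed.

Lemma not_independent (X : sgraph) (A : {set X}) :
  ~~ independent A -> exists x y, [/\ x \in A, y \in A & adj x y].
Proof.
case/forall_inPn=> x xC /forall_inPn[y yC]; rewrite negbK => xy.
by exists x, y.
Qed.

Lemma not_multipartite (X : sgraph) (A : {set X}) :
  ~~ multipartite A ->
  exists x y z, [/\ x \in A, y \in A & z \in A] /\
                [/\ adj x z, ~~ adj x y & ~~ adj y z].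
Proof.
case/forall_inPn=> x xA /forall_inPn[y yA /forall_inPn[z zA]].
by rewrite negb_imply negb_or => /and3P[xz xy yz]; exists x, y, z.
Qed.

Lemma not_clique_free (X : sgraph) (k : nat) (A : {set X}) :
  ~~ clique_free k A ->
  exists C : {set X}, [/\ C \subset A, clique C & k <= #|C|].
Proof.
by case/forallPn=> C; rewrite negb_imply -leqNgt => /andP[/andP[CA cC] kC]; exists C.
Qed.

Lemma cliqueS (X : sgraph) (C D : {set X}) : C \subset D -> clique D -> clique C.
Proof. by move=> /subsetP CD /cliqueP cD; apply/cliqueP=> x y /CD xD /CD; apply: cD. Qed.

(** Non-adjacency in [induced A] means lying in the same block, hence is transitive. A clique has at
    most one vertex in each block, so [pblock Q] is injective on it. *)
Lemma multipartite_le_in (X : sgraph) (A : {set X}) (s : nat) :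
  complete_multipartite_le s (induced A) ->
  multipartite A && clique_free s.+1 A.
Proof.
case=> Q [partQ leQs adjQ]; apply/andP; split.
  apply/multipartiteP=> x y z xA yA zA.
  have adjE u v (uA : u \in A) (vA : v \in A) :
      adj u v = (pblock Q (exist _ u uA) != pblock Q (exist _ v vA)).
    exact: adjQ (exist _ u uA) (exist _ v vA).
  rewrite (adjE x z xA zA) (adjE x y xA yA) (adjE y z yA zA).
  by case: (pblock Q (exist _ x xA) =P pblock Q (exist _ y yA)) => // ->.
apply/clique_freeP => C /subsetP CA /cliqueP cC.
pose C' := [set u : induced A | val u \in C].
have valC' : [set val u | u in C'] = C.
  apply/setP=> x; apply/imsetP/idP => [[u + ->]|xC]; first by rewrite inE.
  by exists (exist _ x (CA x xC)) => //; rewrite inE.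
rewrite -valC' (card_imset _ val_inj) ltnS; apply: leq_trans leQs.
rewrite -(@card_in_imset _ _ (pblock Q)) => [|u v]; last first.
  rewrite !inE => uC vC eq_uv; apply/eqP/negPn/negP => neq_uv.
  have := adjQ u v; rewrite eq_uv eqxx /= /induced_adj cC //.
apply/subset_leq_card/subsetP=> _ /imsetP[u _ ->]; apply: pblock_mem.
by rewrite (cover_partition partQ) inE.
Qed.

(** The parts are the classes of non-adjacency. A transversal of them is a clique, so the bound on
    cliques bounds the number of parts. *)
Lemma multipartite_in_le (X : sgraph) (A : {set X}) (s : nat) :
  multipartite A -> clique_free s.+1 A ->
  complete_multipartite_le s (induced A).
Proof.
move=> /multipartiteP mA /clique_freeP fA.
pose R := [rel x y : induced A | ~~ adj x y].
have eqR : {in [set: induced A] & &, equivalence_rel R}.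
  move=> x y z _ _ _; split=> [|/= nxy]; first exact/negbT/adj_irr.
  have mem (u : induced A) : val u \in A := valP u.
  rewrite /= /induced_adj in nxy *; congr (~~ _); apply/idP/idP => [xz|yz].
    by have:= mA _ _ _ (mem x) (mem y) (mem z) xz; rewrite (negbTE nxy).
  have:= mA _ _ _ (mem y) (mem x) (mem z) yz.
  by rewrite [adj (val y) _]adj_sym (negbTE nxy).
pose Q := equivalence_partition R [set: induced A].
have partQ : partition Q setT := equivalence_partitionP eqR.
have adjQ x y : adj x y = (pblock Q x != pblock Q y).
  rewrite eq_pblock ?(partition_trivIset partQ) ?(cover_partition partQ) ?inE //.
  by rewrite (pblock_equivalence_partition eqR) ?inE //= negbK.
exists Q; split=> //.
have traQ := transversalP partQ.
rewrite -(card_transversal traQ) -ltnS -(card_imset _ val_inj).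
apply: fA; first by apply/subsetP=> _ /imsetP[u _ ->]; apply: valP.
apply/cliqueP=> _ _ /imsetP[u uT ->] /imsetP[v vT ->] neq_uv.
have := adjQ u v; rewrite /= /induced_adj => ->.
apply: contra neq_uv => /eqP eq_uv.
by rewrite (pblock_inj traQ uT vT eq_uv).
Qed.

Lemma cluster1_in (X : sgraph) (B : {set X}) :
  cluster_le 1 (induced B) <-> clique B.
Proof.
split=> [[Q [partQ leQ adjQ]]|/cliqueP cB].
  apply/cliqueP=> x y xB yB neq_xy.
  have := adjQ (exist _ x xB) (exist _ y yB); rewrite /= /induced_adj /= => ->.
  rewrite -val_eqE /= neq_xy /=; apply/eqP.
  by apply: (card_le1_eqP leQ); apply: pblock_mem;
    rewrite (cover_partition partQ) inE.
(* The total relation yields one block if [B] is nonempty and none if it is empty, so both cases are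
   covered. *)
pose Q := equivalence_partition (fun _ _ : induced B => true) setT.
have partQ : partition Q setT by apply: equivalence_partitionP.
have memQ : {in Q, forall S, S = [set: induced B]}.
  by move=> _ /imsetP[x _ ->]; apply/setP=> y; rewrite !inE.
have pQ x : pblock Q x = setT.
  by apply: memQ; rewrite pblock_mem // (cover_partition partQ) inE.
exists Q; split=> // [|x y].
  by apply/card_le1_eqP=> S T /memQ-> /memQ->.
rewrite !pQ eqxx andbT; apply/idP/idP=> [|neq_xy]; first exact: adj_neq.
by apply: cB; rewrite ?(valP x) ?(valP y) // val_eqE.
Qed.

Lemma polar1P (s : nat) (X : sgraph) : reflect (polar s 1 X) (polar1 s X).
Proof.
apply: (iffP existsP) => [[A /and3P[mA fA cA]]|[A [B [AB dAB mA /cluster1_in cB]]]].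
  exists A, (~: A); split; rewrite ?setUCr ?disjoints_subset ?setCK //.
    exact: multipartite_in_le.
  exact/cluster1_in.
exists A; case/andP: (multipartite_le_in mA) => -> -> /=.
apply: cliqueS cB; apply/subsetP=> x; rewrite inE => /negbTE xA.
by have /setUP[|//] : x \in A :|: B; [rewrite AB inE | rewrite xA].
Qed.

(** * Induced embeddings *)

(** The target set [A] keeps track of where a copy lies, so that copies in different places can be
    combined by union or join. *)
Definition embeds_in (L X : sgraph) (A : {set X}) : Prop :=
  exists f : L -> X, [/\ injective f,
    forall x y, adj (f x) (f y) = adj x y & forall x, f x \in A].

Notation embeds L X := (embeds_in L [set: X]).

Definition separated (X : sgraph) (A B : {set X}) : Prop :=
  {in A & B, forall x y, (x != y) && ~~ adj x y}.

(** Injectivity has the contrapositive form, which [embed_with] checks pair by pair on explicit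
    vertices. *)
Lemma embeds_inI (L X : sgraph) (A : {set X}) (f : L -> X) :
  (forall x y, x != y -> f x != f y) ->
  (forall x y, adj (f x) (f y) = adj x y) ->
  (forall x, f x \in A) -> embeds_in L A.
Proof.
move=> inj_f adj_f Af; exists f; split=> // x y /eqP.
by apply: contraTeq; apply: inj_f.
Qed.

Lemma embeds_inS (L X : sgraph) (A B : {set X}) :
  A \subset B -> embeds_in L A -> embeds_in L B.
Proof. by move=> /subsetP AB [f [inj_f adj_f Af]]; exists f; split=> // x; apply: AB. Qed.

Lemma embeds_in_trans (L Y X : sgraph) (A : {set X}) :
  embeds L Y -> embeds_in Y A -> embeds_in L A.
Proof.
move=> [f [inj_f adj_f _]] [g [inj_g adj_g Ag]]; exists (g \o f).
by split=> [|x y|x] /=; [apply: inj_comp | rewrite adj_g | apply: Ag].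
Qed.

Lemma embeds_induced (X : sgraph) (A : {set X}) : embeds_in (induced A) A.
Proof. by exists val; split=> // [|x]; [apply: val_inj | apply: valP]. Qed.

Lemma embeds_of_compl (L X : sgraph) :
  embeds (compl L) (compl X) -> embeds L X.
Proof.
move=> [f [inj_f adj_f _]]; exists f; split=> // x y.
have := adj_f x y; rewrite /= /compl_adj (inj_eq inj_f).
by case: eqVneq => [->|_ /negb_inj //]; rewrite !adj_irr.
Qed.

(** Not an instance of [embeds_of_compl]: a double complement is isomorphic to the graph but not
    convertible to it. *)
Lemma embeds_compl (L X : sgraph) : embeds L (compl X) -> embeds (compl L) X.
Proof.
move=> [f [inj_f adj_f _]]; exists f; split=> // x y.
rewrite /= /compl_adj -adj_f /= /compl_adj (inj_eq inj_f).
by case: eqVneq => [->|]; rewrite ?adj_irr ?negbK.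
Qed.

Lemma embeds_disj_union (K L X : sgraph) (A B : {set X}) :
  separated A B -> embeds_in K A -> embeds_in L B -> embeds (K + L)%sg X.
Proof.
move=> sepAB [f [inj_f adj_f Af]] [g [inj_g adj_g Bg]].
have sep x y : (f x != g y) && ~~ adj (f x) (g y) by apply: sepAB.
exists (fun v => match v with inl x => f x | inr y => g y end).
split=> // -[x|x] [y|y] /=; rewrite ?adj_f ?adj_g //.
- by move/inj_f->.
- by move=> eq_fg; have := sep x y; rewrite eq_fg eqxx.
- by move=> eq_fg; have := sep y x; rewrite eq_fg eqxx.
- by move/inj_g->.
- by case/andP: (sep x y) => _ /negbTE.
- by case/andP: (sep y x) => _ /negbTE; rewrite adj_sym.
Qed.

Lemma embeds_join (K L X : sgraph) (A B D : {set X}) :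
  {in A & B, forall x y, adj x y} -> A \subset D -> B \subset D ->
  embeds_in K A -> embeds_in L B -> embeds_in (K ⊕ L)%sg D.
Proof.
move=> adjAB /subsetP AD /subsetP BD [f [inj_f adj_f Af]] [g [inj_g adj_g Bg]].
have adj_fg x y : adj (f x) (g y) by apply: adjAB.
have adj_gf x y : adj (g x) (f y) by rewrite adj_sym.
exists (fun v => match v with inl x => f x | inr y => g y end).
split=> [[x|x] [y|y]|[x|x] [y|y]|[x|x]] /=.
- by move/inj_f->.
- by move/eqP; rewrite (negbTE (adj_neq (adj_fg x y))).
- by move/eqP; rewrite (negbTE (adj_neq (adj_gf x y))).
- by move/inj_g->.
- rewrite /compl_adj /= /compl_adj adj_f (inj_eq (@inl_inj _ _)).
  by case: eqVneq => [->|] //=; rewrite ?adj_irr ?negbK.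
- by rewrite adj_fg.
- by rewrite adj_gf.
- rewrite /compl_adj /= /compl_adj adj_g (inj_eq (@inr_inj _ _)).
  by case: eqVneq => [->|] //=; rewrite ?adj_irr ?negbK.
- exact: AD.
- exact: BD.
Qed.

Lemma embeds_copies2 (L X : sgraph) (A B : {set X}) :
  separated A B -> embeds_in L A -> embeds_in L B -> embeds (copies 2 L) X.
Proof.
move=> sepAB [f [inj_f adj_f Af]] [g [inj_g adj_g Bg]].
(* The two copies are first placed as a disjoint union; the index in ['I_2] then selects the
   summand. *)
have [h [inj_h adj_h _]] : embeds (L + L)%sg X.
  by apply: embeds_disj_union sepAB _ _; [exists f | exists g].
exists (fun u => h (if u.1 == ord0 then inl u.2 else inr u.2)).
have eq2 (i j : 'I_2) : (i == ord0) = (j == ord0) -> i = j.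
  case: i j => [[|[|//]] ?] [[|[|//]] ?] //=; rewrite -?val_eqE // => _; exact: val_inj.
split=> // [[i x] [j y]|[i x] [j y]] /=.
  by case i0: (i == ord0) (eq2 i j); case j0: (j == ord0) => eqij /inj_h // [->]; rewrite eqij.
rewrite adj_h /= /copies_adj /=; case: (eqVneq i j) => [<-|]; first by case: ifP.
by case i0: (i == ord0) (eq2 i j); case j0: (j == ord0) => //= ->; rewrite ?eqxx.
Qed.

Lemma embeds_complete (X : sgraph) (C : {set X}) (n : nat) :
  clique C -> n <= #|C| -> embeds_in (complete_graph n) C.
Proof.
move=> /cliqueP cC nC.
have inj_f : injective (fun i : 'I_n => enum_val (widen_ord nC i)).
  by move=> i j /enum_val_inj/(congr1 val)/= eq_ij; apply: val_inj.
exists (fun i => enum_val (widen_ord nC i)); split=> // [i j|i]; last exact: enum_valP.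
rewrite /= /complete_adj; apply/idP/idP => [/adj_neq|]; rewrite -?(inj_eq inj_f) //.
by apply: cC; apply: enum_valP.
Qed.

Lemma embeds_complete1 (X : sgraph) (u : X) (A : {set X}) :
  u \in A -> embeds_in (complete_graph 1) A.
Proof.
move=> uA; apply: (@embeds_inS _ _ [set u]); first by rewrite sub1set.
by apply: embeds_complete; rewrite ?cards1 //; apply/cliqueP=> x y /set1P-> /set1P->; rewrite eqxx.
Qed.

Lemma embeds_complete2 (X : sgraph) (u v : X) (A : {set X}) :
  u \in A -> v \in A -> adj u v -> embeds_in (complete_graph 2) A.
Proof.
move=> uA vA uv; apply: (@embeds_inS _ _ [set u; v]); first by rewrite subUset !sub1set uA.
apply: embeds_complete; last by rewrite cards2 adj_neq.
by apply/cliqueP=> x y /set2P[]-> /set2P[]->; rewrite ?eqxx // adj_sym.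
Qed.

(* Enumerates ordinals below 5 only. *)
Ltac destruct_vertex x :=
  let T := type of x in let T' := eval hnf in T in
  match T' with
  | sum _ _ => destruct x as [x|x]; destruct_vertex x
  | prod _ _ => let y := fresh in destruct x as [x y]; destruct_vertex x; destruct_vertex y
  | option _ => destruct x as [x|]; [destruct_vertex x | idtac]
  | ordinal _ => let m := fresh in destruct x as [m x];
      do 5 (try destruct m as [|m]); try discriminate x
  end.

(** Records every known adjacency or non-adjacency in both orientations as a boolean equation, so
    that each entry of an adjacency table is closed by [assumption]. *)
Ltac saturate_adj :=
  repeat match goal with
  | H : is_true (~~ (?x == ?y)) |- _ => move/eqP: H => H
  | H : is_true (~~ adj ?x ?y) |- _ =>
      let H' := fresh in
      move/negbTE: H => H; have H' : adj y x = false by [rewrite adj_sym]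
  | H : is_true (adj ?x ?y) |- _ =>
      let H' := fresh in
      have H' : adj y x = true; [by rewrite adj_sym | change (adj x y = true) in H]
  end.

(** Vertices are told apart by an assumed inequality, by being adjacent, or by a third vertex
    adjacent to exactly one of them. *)
Ltac contradict_eq :=
  match goal with
  | E : ?x = ?y, N : ?x <> ?y |- _ => case: (N E)
  | E : ?x = ?y, N : ?y <> ?x |- _ => case: (N (esym E))
  | E : ?x = ?y, H : adj ?x ?y = true |- _ => by rewrite E adj_irr in H
  | E : ?x = ?y, H : adj ?x ?z = true, H' : adj ?y ?z = false |- _ =>
      by rewrite E H' in H
  | E : ?x = ?y, H : adj ?x ?z = false, H' : adj ?y ?z = true |- _ =>
      by rewrite E H' in H
  end.

Ltac embed_with f :=
  match goal with |- @embeds_in ?L ?X ?A => apply: (@embeds_inI L X A f) end;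
  [ let x := fresh in let y := fresh in
    intros x y; destruct_vertex x; destruct_vertex y;
    match goal with |- is_true (~~ ?b) -> _ =>
      let v := eval vm_compute in b in
      match v with
      | true => let H := fresh in intro H; vm_compute in H; discriminate H
      | false => move=> _ /=; apply/eqP => ?; contradict_eq
      end
    end
  | let x := fresh in let y := fresh in
    intros x y; destruct_vertex x; destruct_vertex y;
    solve [ exact: adj_irr | match goal with |- _ = ?r =>
      let b := eval vm_compute in r in transitivity b; [assumption | reflexivity] end ]
  | let x := fresh in intro x; destruct_vertex x; solve [ by rewrite /= ?inE ] ].

(** * Induced copies of small graphs from adjacency data *)

Lemma embeds_path3 (X : sgraph) (A : {set X}) (a b c : X) :
  a \in A -> b \in A -> c \in A ->
  adj a b -> adj b c -> a != c -> ~~ adj a c -> embeds_in (path_graph 3) A.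
Proof.
move=> aA bA cA *; saturate_adj.
embed_with (fun i : 'I_3 => nth a [:: a; b; c] i).
Qed.

Lemma embeds_edge_plus (X : sgraph) (a b c d e : X) :
  adj a b -> adj c d -> ~~ adj a c -> ~~ adj a d -> ~~ adj b c -> ~~ adj b d ->
  ~~ adj a e -> ~~ adj b e -> ~~ adj c e -> ~~ adj d e ->
  embeds (complete_graph 1 + copies 2 (complete_graph 2))%sg X.
Proof.
move=> *; saturate_adj.
embed_with (fun v : 'I_1 + 'I_2 * 'I_2 => match v with
  | inl _ => e
  | inr (i, j) => nth e (nth [::] [:: [:: a; b]; [:: c; d]] i) j
  end).
Qed.

(** Opposite vertices have the same neighbours on the cycle, so adjacencies cannot tell them apart
    and their distinctness is assumed. The same holds for the two ends of a path on three
    vertices. *)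
Lemma embeds_cycle4 (X : sgraph) (A : {set X}) (a b c d : X) :
  a \in A -> b \in A -> c \in A -> d \in A ->
  adj a b -> adj b c -> adj c d -> adj a d ->
  a != c -> ~~ adj a c -> b != d -> ~~ adj b d -> embeds_in (cycle_graph 4) A.
Proof.
move=> aA bA cA dA *; saturate_adj.
embed_with (fun i : 'I_4 => nth a [:: a; b; c; d] i).
Qed.

Lemma embeds_cycle5 (X : sgraph) (a b c d e : X) :
  adj a b -> adj b c -> adj c d -> adj d e -> adj a e ->
  ~~ adj a c -> ~~ adj a d -> ~~ adj b d -> ~~ adj b e -> ~~ adj c e ->
  embeds (cycle_graph 5) X.
Proof.
move=> *; saturate_adj.
embed_with (fun i : 'I_5 => nth a [:: a; b; c; d; e] i).
Qed.

Lemma embeds_path5 (X : sgraph) (a b c d e : X) :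
  adj a b -> adj b c -> adj c d -> adj d e ->
  ~~ adj a c -> ~~ adj a d -> ~~ adj a e -> ~~ adj b d -> ~~ adj b e ->
  ~~ adj c e -> embeds (path_graph 5) X.
Proof.
move=> *; saturate_adj.
embed_with (fun i : 'I_5 => nth a [:: a; b; c; d; e] i).
Qed.

Lemma embeds_path3_edge (X : sgraph) (a b c d e : X) :
  adj a b -> adj b c -> a != c -> ~~ adj a c -> adj d e ->
  ~~ adj a d -> ~~ adj a e -> ~~ adj b d -> ~~ adj b e ->
  ~~ adj c d -> ~~ adj c e -> embeds (path_graph 3 + complete_graph 2)%sg X.
Proof.
move=> *; saturate_adj.
embed_with (fun v : 'I_3 + 'I_2 => match v with
  | inl i => nth a [:: a; b; c] i
  | inr i => nth a [:: d; e] i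
  end).
Qed.

(* A triangle [b d e] with the path [e c a] attached at [e]; in the complement,
   [a b c d] is the 4-cycle and [e] hangs from [a]. *)
Lemma embeds_compl_banner (X : sgraph) (a b c d e : X) :
  adj b d -> adj b e -> adj d e -> adj c e -> adj a c ->
  ~~ adj a b -> ~~ adj a d -> ~~ adj a e -> ~~ adj b c -> ~~ adj c d ->
  embeds (compl banner) X.
Proof.
move=> *; saturate_adj.
embed_with (fun v : option 'I_4 => match v with
  | Some i => nth a [:: a; b; c; d] i
  | None => e
  end).
Qed.

(** Two triangles [a c e] and [b d e] share [e]; in the complement, [a b c d] is a 4-cycle and [e]
    is isolated. *)
Lemma embeds_butterfly (X : sgraph) (a b c d e : X) :
  adj a c -> adj b d -> adj a e -> adj b e -> adj c e -> adj d e ->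
  ~~ adj a b -> ~~ adj a d -> ~~ adj b c -> ~~ adj c d ->
  embeds (compl (complete_graph 1 + cycle_graph 4)%sg) X.
Proof.
move=> *; saturate_adj.
embed_with (fun v : 'I_1 + 'I_4 => match v with
  | inl _ => e
  | inr i => nth a [:: a; b; c; d] i
  end).
Qed.

Lemma embeds_copies2_complete1 (X : sgraph) (A : {set X}) (x y : X) :
  x \in A -> y \in A -> x != y -> ~~ adj x y ->
  embeds_in (copies 2 (complete_graph 1)) A.
Proof.
move=> *; saturate_adj.
embed_with (fun u : 'I_2 * 'I_1 => nth x [:: x; y] u.1).
Qed.

(** * The listed graphs are not polar *)

Definition isolated (X : sgraph) (u : X) := [forall x, ~~ adj u x].

Lemma isolatedP (X : sgraph) (u : X) :
  reflect (forall x, adj u x = false) (isolated u).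
Proof. by apply: (iffP forallP) => uX x; [apply/negbTE | rewrite uX]. Qed.

Lemma separatedC (X : sgraph) (A B : {set X}) : separated A B -> separated B A.
Proof. by move=> sAB x y xB yA; rewrite eq_sym adj_sym; apply: sAB. Qed.

Lemma embeds_isolated (L X : sgraph) (u : X) :
  isolated u -> embeds_in L [set~ u] -> embeds (complete_graph 1 + L)%sg X.
Proof.
move=> /isolatedP iu; apply: (@embeds_disj_union _ _ _ [set u]).
  by move=> x y /set1P->; rewrite !inE iu eq_sym => ->.
by apply: embeds_complete1; rewrite inE.
Qed.

(** The vertex of the copy of [K_1] pairs with [u] to give [2K_1]. This turns a [K_1 + C_4] that
    avoids [u] into [2K_1 + C_4]. *)
Lemma embeds_two_isolated (L X : sgraph) (u : X) :
  isolated u -> embeds_in (complete_graph 1 + L)%sg [set~ u] ->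
  embeds (copies 2 (complete_graph 1) + L)%sg X.
Proof.
move=> /isolatedP iu [f [inj_f adj_f fu]]; pose v := f (inl ord0).
have neq_u x : (u != f x) by have := fu x; rewrite !inE eq_sym.
apply: (@embeds_disj_union _ _ _ [set u; v] [set f (inr x) | x : L]).
- move=> _ _ /set2P[]-> /imsetP[x _ ->]; first by rewrite neq_u iu.
  by rewrite adj_f andbT (inj_eq inj_f).
- by apply: (@embeds_copies2_complete1 _ _ u v); rewrite ?iu ?neq_u // !inE eqxx ?orbT.
- exists (fun x => f (inr x)); split=> [x y /inj_f [] //|x y|x].
    by rewrite adj_f.
  exact: imset_f.
Qed.

Lemma embeds_inr (K L : sgraph) : embeds L (K + L)%sg.
Proof. by exists inr; split=> // x y []. Qed.

Lemma split_graph_embeds (L X : sgraph) :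
  embeds L X -> split_graph X -> split_graph L.
Proof.
move=> [f [inj_f adj_f _]] /existsP[A /andP[/independentP iA /cliqueP cA]].
apply/existsP; exists (f @^-1: A); apply/andP; split.
  by apply/independentP=> x y; rewrite !inE -adj_f; apply: iA.
apply/cliqueP=> x y; rewrite !inE -adj_f -(inj_eq inj_f) => xA yA.
by apply: cA; rewrite inE.
Qed.

Lemma polar1_embeds (s : nat) (L X : sgraph) :
  embeds L X -> polar1 s X -> polar1 s L.
Proof.
move=> [f [inj_f adj_f _]].
move=> /existsP[A /and3P[/multipartiteP mA /clique_freeP fA /cliqueP cA]].
apply/existsP; exists (f @^-1: A); apply/and3P; split.
- by apply/multipartiteP=> x y z; rewrite !inE -!adj_f; apply: mA.
- apply/clique_freeP=> C /subsetP CA /cliqueP cC.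
  rewrite -(card_imset _ inj_f); apply: fA.
    by apply/subsetP=> _ /imsetP[x /CA + ->]; rewrite inE.
  apply/cliqueP=> _ _ /imsetP[x xC ->] /imsetP[y yC ->].
  by rewrite adj_f (inj_eq inj_f); apply: cC.
- apply/cliqueP=> x y; rewrite !inE -adj_f -(inj_eq inj_f) => xA yA.
  by apply: cA; rewrite inE.
Qed.

(** If the image of [L] were a proper subset, the subgraph induced on it would be polar by
    minimality, and so would [L]. Hence the embedding is onto. *)
Lemma minimal_obstruction_embeds (s : nat) (L G : sgraph) :
  minimal_polar_obstruction s 1 G -> ~~ polar1 s L -> embeds L G -> G ≅ L.
Proof.
move=> [_ minG] npL [f [inj_f adj_f _]].
have mem_f x : f x \in [set f x | x : L] by apply: imset_f.
have imf : [set f x | x : L] = [set: G].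
  apply/eqP/negPn/negP; rewrite -properT => /minG/polar1P.
  apply/negP; apply: contra npL; apply: polar1_embeds.
  exists (fun x => exist _ (f x) (mem_f x)); split=> // x y.
  by move/(congr1 val)/inj_f.
have [g fK gK] : bijective f.
  by apply: inj_card_bij => //; rewrite -cardsT -imf card_imset.
by exists g; split=> [|x y]; [exists f | rewrite -adj_f !gK].
Qed.

(** If [u] lies in the multipartite part, that part has no edge, because [u] is adjacent to neither
    end of one; then [X] is split. If [u] lies in the clique, the clique is [{u}] and the
    multipartite part is everything else. *)
Lemma not_polar1_isolated (s : nat) (X : sgraph) (u : X) :
  isolated u -> ~~ split_graph X ->
  ~~ (multipartite [set~ u] && clique_free s.+1 [set~ u]) -> ~~ polar1 s X.
Proof.
move=> /isolatedP iu nsX nmX; apply/existsP=> -[A /and3P[mA fA cA]].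
case: (boolP (u \in A)) => uA.
  case/existsP: nsX; exists A; rewrite cA andbT; apply/independentP=> x y xA yA.
  apply/negP=> /(multipartiteP _ mA x u y xA uA yA).
  by rewrite iu adj_sym iu.
have defA : A = [set~ u].
  apply/setP=> x; rewrite !inE; apply/idP/idP => [|neq_xu].
    by apply: contraTneq => ->.
  apply/negPn/negP => xA.
  by have := cliqueP _ cA u x; rewrite !inE uA xA eq_sym neq_xu iu => /(_ isT isT isT).
by rewrite -defA mA fA in nmX.
Qed.

(** The clique cannot meet both sides ([cross]), so [B] contains a whole side, which has an edge. A
    multipartite set containing an edge of one side contains no vertex of the other ([edge]), so [B]
    equals that side. *)
Lemma polar1_separated (s : nat) (X : sgraph) (A : {set X}) :
  separated A (~: A) -> ~~ independent A -> ~~ independent (~: A) ->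
  polar1 s X ->
  exists2 B, (B = A) \/ (B = ~: A) &
             [/\ multipartite B, clique_free s.+1 B & clique (~: B)].
Proof.
move=> sA /not_independent[a [b [aA bA ab]]] /not_independent[c [d [cA dA cd]]].
move=> /existsP[B /and3P[mB fB cB]].
have sep x y : x \in A -> y \in ~: A -> (adj x y = false) * (adj y x = false) * (x != y).
  move=> xA yA; have /andP[-> /negbTE nxy] := sA x y xA yA.
  by rewrite [adj y x]adj_sym nxy.
have cross x y : x \in A -> y \in ~: A -> (x \in B) || (y \in B).
  move=> xA yA; apply/negPn/negP; rewrite negb_or => /andP[xB yB].
  have := cliqueP _ cB x y; rewrite !inE => /(_ xB yB).
  by rewrite !(sep x y) // => /(_ isT).
have edge (D : {set X}) x y z :
    separated D (~: D) -> x \in D -> y \in D -> adj x y -> z \in ~: D ->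
    x \in B -> y \in B -> z \notin B.
  move=> sD xD yD xy zD xB yB; apply/negP=> zB.
  have /andP[_ /negbTE nxz] := sD x z xD zD.
  have /andP[_ /negbTE nyz] := sD y z yD zD.
  have := multipartiteP _ mB x z y xB zB yB xy.
  by rewrite nxz adj_sym nyz.
have sA' : separated (~: A) (~: ~: A) by rewrite setCK; apply: separatedC.
case: (boolP ((a \in B) && (b \in B))) => [/andP[aB bB]|nab].
  have A'B z : z \in ~: A -> z \notin B by move=> zA; apply: (edge A a b z).
  exists B => //; left; apply/setP=> x; apply/idP/idP => [xB|xA].
    by apply: contraLR xB => xA; apply: A'B; rewrite inE.
  by have := cross x c xA cA; rewrite (negbTE (A'B c cA)) orbF.
have A'B z : z \in ~: A -> z \in B.
  move=> zA; case/nandP: nab => [/negbTE aB|/negbTE bB].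
    by have := cross a z aA zA; rewrite aB.
  by have := cross b z bA zA; rewrite bB.
exists B => //; right; apply/setP=> x; apply/idP/idP => [xB|]; last exact: A'B.
rewrite inE; apply/negP=> xA.
have := edge (~: A) c d x sA' cA dA cd _ (A'B c cA) (A'B d dA).
by rewrite setCK xB xA => /(_ isT).
Qed.

(** * Small graphs that are not split *)

Ltac decide_memberships A vs :=
  match vs with
  | nil => idtac
  | ?v :: ?vs' => let H := fresh in case: (boolP (v \in A)) => H; decide_memberships A vs'
  end.

(** Runs through all distributions of the listed vertices between the two parts; each one leaves an
    edge in the independent part or a non-edge in the clique. *)
Ltac not_split vs :=
  let A := fresh in let iA := fresh in let cA := fresh in
  apply/existsP=> -[A /andP[/independentP iA /cliqueP cA]];
  decide_memberships A vs;
  solve [ match goal with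
    | H : is_true (?x \in _), H' : is_true (?y \in _) |- _ =>
        by have := iA x y H H'; vm_compute
    | H : is_true (?x \notin _), H' : is_true (?y \notin _) |- _ =>
        by have := cA x y; rewrite inE => /(_ H); rewrite inE => /(_ H' isT); vm_compute
    end ].

Notation "i @ n" := (@Ordinal n i isT) (at level 10).

Lemma not_split_cycle4 : ~~ split_graph (cycle_graph 4).
Proof. not_split [:: 0@4; 1@4; 2@4; 3@4]. Qed.

Lemma not_split_cycle5 : ~~ split_graph (cycle_graph 5).
Proof. not_split [:: 0@5; 1@5; 2@5; 3@5; 4@5]. Qed.

Lemma not_split_copies2_complete2 : ~~ split_graph (copies 2 (complete_graph 2)).
Proof. not_split [:: (0@2, 0@2); (0@2, 1@2); (1@2, 0@2); (1@2, 1@2)]. Qed.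

(** The edge [x z] and the vertex [y] off it break the transitivity of non-adjacency outside [u],
    whatever [s] is. *)
Lemma not_polar1_isolated3 (s : nat) (X : sgraph) (u x y z : X) :
  isolated u -> ~~ split_graph X -> x != u -> y != u -> z != u ->
  adj x z -> ~~ adj x y -> ~~ adj y z -> ~~ polar1 s X.
Proof.
move=> iu nsX xu yu zu xz nxy nyz; apply: (not_polar1_isolated iu nsX).
apply/nandP; left; apply/negP=> /multipartiteP/(_ x y z).
by rewrite !inE (negbTE nxy) (negbTE nyz) => /(_ xu yu zu xz).
Qed.

Lemma not_split_embeds (L X : sgraph) :
  embeds L X -> ~~ split_graph L -> ~~ split_graph X.
Proof. by move=> LX; apply/contra/split_graph_embeds. Qed.

Lemma not_split_inr (K L : sgraph) : ~~ split_graph L -> ~~ split_graph (K + L)%sg.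
Proof. exact/not_split_embeds/embeds_inr. Qed.

Lemma isolated_inl (L : sgraph) :
  isolated (inl ord0 : (complete_graph 1 + L)%sg).
Proof. by apply/isolatedP=> -[x|x] //; rewrite (ord1 x) adj_irr. Qed.

Lemma not_split_join_inl (K L : sgraph) : ~~ split_graph K -> ~~ split_graph (K ⊕ L)%sg.
Proof.
apply: not_split_embeds; exists inl; split=> // [x y [] //|x y].
rewrite /= /compl_adj /= /compl_adj (inj_eq (@inl_inj _ _)).
by case: eqVneq => [->|_] /=; rewrite ?adj_irr ?negbK.
Qed.

Lemma not_polar1_K1_plus (s : nat) (L : sgraph) (x y z : L) :
  ~~ split_graph L -> adj x z -> ~~ adj x y -> ~~ adj y z ->
  ~~ polar1 s (complete_graph 1 + L)%sg.
Proof.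
move=> nsL xz nxy nyz.
apply: (@not_polar1_isolated3 s (complete_graph 1 + L) _ (inr x) (inr y) (inr z)
          (isolated_inl L)) => //.
exact: not_split_inr.
Qed.

Lemma not_polar1_2K2 (s : nat) :
  ~~ polar1 s (complete_graph 1 + copies 2 (complete_graph 2))%sg.
Proof.
apply: (@not_polar1_K1_plus s (copies 2 (complete_graph 2))
          (0@2, 0@2) (1@2, 0@2) (0@2, 1@2)) => //.
exact: not_split_copies2_complete2.
Qed.

Lemma not_polar1_2K1_C4 (s : nat) :
  ~~ polar1 s (copies 2 (complete_graph 1) + cycle_graph 4)%sg.
Proof.
apply: (@not_polar1_isolated3 s (copies 2 (complete_graph 1) + cycle_graph 4)
          (inl (0@2, 0@1)) (inr (0@4)) (inl (1@2, 0@1)) (inr (1@4))) => //.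
  by apply/isolatedP=> -[[i x]|x] //; rewrite (ord1 x) /= /copies_adj andbF.
exact/not_split_inr/not_split_cycle4.
Qed.

Lemma not_polar1_co_P3_K2 (s : nat) :
  ~~ polar1 s (complete_graph 1 + compl (path_graph 3 + complete_graph 2))%sg.
Proof.
apply: (@not_polar1_K1_plus s (compl (path_graph 3 + complete_graph 2))
          (inl (0@3)) (inl (1@3)) (inl (2@3))) => //.
apply: not_split_embeds not_split_cycle4.
(* The first edge of the path and the separate [K_2] form [2K_2], which the complement turns into a
   4-cycle. *)
by apply: (@embeds_cycle4 (compl (path_graph 3 + complete_graph 2)) _
          (inl (0@3)) (inr (0@2)) (inl (1@3)) (inr (1@2))); rewrite ?inE.
Qed.

Lemma not_polar1_C5 (s : nat) :
  ~~ polar1 s (complete_graph 1 + cycle_graph 5)%sg.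
Proof.
apply: (@not_polar1_K1_plus s (cycle_graph 5) (0@5) (3@5) (1@5)) => //.
exact: not_split_cycle5.
Qed.

Lemma not_polar1_banner (s : nat) : ~~ polar1 s (complete_graph 1 + banner)%sg.
Proof.
apply: (@not_polar1_K1_plus s banner (Some (1@4)) None (Some (2@4))) => //.
apply: not_split_embeds not_split_cycle4.
by exists Some; split=> // x y [].
Qed.

Lemma not_polar1_co_P5 (s : nat) :
  ~~ polar1 s (complete_graph 1 + compl (path_graph 5))%sg.
Proof.
apply: (@not_polar1_K1_plus s (compl (path_graph 5)) (0@5) (1@5) (2@5)) => //.
apply: not_split_embeds not_split_cycle4.
(* The two end edges of the path form [2K_2], hence a 4-cycle in the complement. *)
by apply: (@embeds_cycle4 (compl (path_graph 5)) _ (0@5) (3@5) (1@5) (4@5)); rewrite ?inE.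
Qed.

Lemma not_clique_free_sub (X : sgraph) (k : nat) (A : {set X}) (C : {set X}) :
  C \subset A -> clique C -> k <= #|C| -> ~~ clique_free k A.
Proof.
move=> CA cC kC; apply/negP=> /clique_freeP/(_ C CA cC).
by rewrite ltnNge kC.
Qed.

Lemma clique_join_complete (n : nat) (K : sgraph) (C : {set K}) :
  clique C ->
  exists D : {set (K ⊕ complete_graph n)%sg}, clique D /\ #|D| = #|C| + n.
Proof.
move=> /cliqueP cC.
have inlI : injective (inl : K -> (K ⊕ complete_graph n)%sg) by move=> x y [].
have inrI : injective (inr : 'I_n -> (K ⊕ complete_graph n)%sg) by move=> x y [].
exists ([set (inl x : (K ⊕ complete_graph n)%sg) | x in C]
        :|: [set (inr i : (K ⊕ complete_graph n)%sg) | i : 'I_n]); split.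
  apply/cliqueP=> _ _ /setUP[]/imsetP[x xC ->] /setUP[]/imsetP[y yC ->] //=.
    move=> neq; have neq_xy : x != y by apply: contra neq => /eqP->.
    by rewrite /compl_adj neq /= /compl_adj neq_xy negbK cC.
  move=> neq; have neq_xy : x != y by apply: contra neq => /eqP->.
  by rewrite /compl_adj neq /= /compl_adj neq_xy negbK.
rewrite cardsU !card_imset ?card_ord; try exact: inlI; try exact: inrI.
rewrite (_ : _ :&: _ = set0) ?cards0 ?subn0 ?card_ord //.
by apply/setP=> v; rewrite !inE; apply/negP=> /andP[/imsetP[x _ ->] /imsetP[y _]].
Qed.

Lemma not_clique_free_inr (k : nat) (K L : sgraph) (A : {set (K + L)%sg})
    (D : {set L}) :
  {in D, forall x, inr x \in A} -> clique D -> k <= #|D| -> ~~ clique_free k A.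
Proof.
move=> DA /cliqueP cD kD; have inrI : injective (inr : L -> (K + L)%sg) by move=> x y [].
apply: (@not_clique_free_sub _ _ _ [set (inr x : (K + L)%sg) | x in D]).
- by apply/subsetP=> _ /imsetP[x /DA xA ->].
- apply/cliqueP=> _ _ /imsetP[x xD ->] /imsetP[y yD ->].
  by rewrite (inj_eq inrI); apply: cD.
- by rewrite card_imset.
Qed.

Lemma not_polar1_C4_join (s : nat) :
  2 <= s -> ~~ polar1 s (complete_graph 1 + (cycle_graph 4 ⊕ complete_graph (s - 1)))%sg.
Proof.
move=> hs; apply: (@not_polar1_isolated _ _ _ (isolated_inl _)).
  exact/not_split_inr/not_split_join_inl/not_split_cycle4.
apply/nandP; right.
(* An edge of the 4-cycle together with [K_(s-1)] is a clique of size [2 + (s - 1)], which is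
   [s + 1] because [s] is positive. *)
have [|D [cD cardD]] := @clique_join_complete (s - 1) (cycle_graph 4) [set 0@4; 1@4].
  by apply/cliqueP=> x y /set2P[]-> /set2P[]->.
apply: not_clique_free_inr cD _ => [x _|]; first by rewrite !inE.
by rewrite cardD cards2 add2n subn1 prednK // ltnW.
Qed.

Lemma separated_fst (L : sgraph) :
  separated [set u : copies 2 L | u.1 == ord0] (~: [set u : copies 2 L | u.1 == ord0]).
Proof.
move=> [i x] [j y]; rewrite !inE /= => /eqP-> j0.
have ne0j : (ord0 == j) = false by rewrite eq_sym (negbTE j0).
by rewrite /copies_adj /= xpair_eqE ne0j.
Qed.


Lemma not_polar1_separated (s : nat) (X : sgraph) (A : {set X}) :
  separated A (~: A) -> ~~ independent A -> ~~ independent (~: A) ->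
  ~~ (clique_free s.+1 A && clique (~: A)) ->
  ~~ (clique_free s.+1 (~: A) && clique A) -> ~~ polar1 s X.
Proof.
move=> sA iA iA' nA nA'; apply/negP=> /(polar1_separated sA iA iA').
by case=> B [->|->] [_ fB cB]; [rewrite fB cB in nA | rewrite setCK in cB; rewrite fB cB in nA'].
Qed.

Lemma not_clique_pair (X : sgraph) (A : {set X}) (x y : X) :
  x \in A -> y \in A -> x != y -> ~~ adj x y -> ~~ clique A.
Proof. by move=> xA yA neq nxy; apply/negP=> /cliqueP/(_ x y xA yA neq); apply/negP. Qed.

Lemma not_independent_pair (X : sgraph) (A : {set X}) (x y : X) :
  x \in A -> y \in A -> adj x y -> ~~ independent A.
Proof. by move=> xA yA xy; apply/negP=> /independentP/(_ x y xA yA); rewrite xy. Qed.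

Lemma not_polar1_2P3 (s : nat) : ~~ polar1 s (copies 2 (path_graph 3)).
Proof.
apply: (not_polar1_separated (@separated_fst _)).
- by apply: (@not_independent_pair (copies 2 (path_graph 3)) _ (0@2, 0@3) (0@2, 1@3)); rewrite ?inE.
- by apply: (@not_independent_pair (copies 2 (path_graph 3)) _ (1@2, 0@3) (1@2, 1@3)); rewrite ?inE.
- apply/nandP; right.
  by apply: (@not_clique_pair (copies 2 (path_graph 3)) _ (1@2, 0@3) (1@2, 2@3)); rewrite ?inE.
- apply/nandP; right.
  by apply: (@not_clique_pair (copies 2 (path_graph 3)) _ (0@2, 0@3) (0@2, 2@3)); rewrite ?inE.
Qed.

Lemma not_clique_free_copy (n : nat) (i : 'I_2) (A : {set copies 2 (complete_graph n)}) :
  (forall j : 'I_n, (i, j) \in A) -> ~~ clique_free n A.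
Proof.
move=> Ai; pose inj_i (j : 'I_n) : copies 2 (complete_graph n) := (i, j).
apply: (@not_clique_free_sub _ _ _ [set inj_i j | j : 'I_n]).
- by apply/subsetP=> _ /imsetP[j _ ->].
- apply/cliqueP=> _ _ /imsetP[j _ ->] /imsetP[k _ ->].
  by rewrite -pair_eqE /pair_eq /= /copies_adj /= eqxx.
- by rewrite card_imset ?card_ord // => j k [].
Qed.

Lemma not_polar1_2K (s : nat) : 1 <= s -> ~~ polar1 s (copies 2 (complete_graph s.+1)).
Proof.
(* Since [s] is positive, each copy has two distinct vertices and so an edge. *)
move=> hs; have neq01 : (ord0 : 'I_s.+1) != ord_max by rewrite -val_eqE /= neq_ltn hs.
apply: (not_polar1_separated (@separated_fst _)).
- by apply: (@not_independent_pair (copies 2 (complete_graph s.+1)) _ (0@2, ord0) (0@2, ord_max)); rewrite ?inE.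
- by apply: (@not_independent_pair (copies 2 (complete_graph s.+1)) _ (1@2, ord0) (1@2, ord_max)); rewrite ?inE.
- by apply/nandP; left; apply: (@not_clique_free_copy _ (0@2)) => j; rewrite inE.
- by apply/nandP; left; apply: (@not_clique_free_copy _ (1@2)) => j; rewrite !inE.
Qed.

(** The join side is not a clique because of its [2K_1]. It cannot be the multipartite part either:
    one vertex of [2K_1] together with [K_s] is a clique of size [s + 1]. *)
Lemma not_polar1_K2_join (s : nat) : 1 <= s ->
  ~~ polar1 s (complete_graph 2 + (copies 2 (complete_graph 1) ⊕ complete_graph s))%sg.
Proof.
move=> hs; set X := (_ + _)%sg.
pose A := [set u : X | if u is inl _ then true else false].
apply: (@not_polar1_separated s X A).
- by case=> x [y|y]; rewrite !inE.
- by apply: (@not_independent_pair X _ (inl (0@2)) (inl (1@2))); rewrite ?inE.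
- by apply: (@not_independent_pair X _ (inr (inl (0@2, 0@1))) (inr (inr (Ordinal hs)))); rewrite ?inE.
- apply/nandP; right.
  by apply: (@not_clique_pair X _ (inr (inl (0@2, 0@1))) (inr (inl (1@2, 0@1)))); rewrite ?inE.
- apply/nandP; left.
  have [|D [cD cardD]] := @clique_join_complete s (copies 2 (complete_graph 1)) [set (0@2, 0@1)].
    by apply/cliqueP=> x y /set1P-> /set1P->; rewrite eqxx.
  apply: not_clique_free_inr cD _ => [x _|]; first by rewrite !inE.
  by rewrite cardD cards1.
Qed.

(** * Forbidden subgraphs *)

Definition has_2K2 (X : sgraph) : Prop :=
  exists a b c d : X, [/\ adj a b, adj c d, ~~ adj a c & ~~ adj a d] /\
                      (~~ adj b c /\ ~~ adj b d).

Definition has_C4 (X : sgraph) : Prop :=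
  exists a b c d : X, [/\ adj a b, adj b c, adj c d & adj a d] /\
                      [/\ a != c, ~~ adj a c, b != d & ~~ adj b d].

Lemma clique_setU1 (X : sgraph) (K : {set X}) (x : X) :
  clique K -> {in K, forall u, adj x u} -> clique (x |: K).
Proof.
move=> /cliqueP cK xK; apply/cliqueP=> a b /setU1P[->|aK] /setU1P[->|bK].
- by rewrite eqxx.
- by move=> _; apply: xK.
- by move=> _; rewrite adj_sym; apply: xK.
- exact: cK.
Qed.

(** Outside a maximum clique [K] there is an edge [x y]. If the sets of non-neighbours of [x] and
    [y] in [K] are incomparable, a 4-cycle arises; if they are nested, [main] applies, using the
    choice of [K] by degree sum. *)
Lemma foldes_hammer (X : sgraph) :
  ~~ split_graph X -> [\/ has_2K2 X, has_C4 X | embeds (cycle_graph 5) X].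
Proof.
move=> nsX; pose N v := [set w : X | adj v w].
pose weight (C : {set X}) := \sum_(v in C) #|N v|.
have c0 : clique (set0 : {set X}) by apply/cliqueP=> x y; rewrite inE.
(* [K] maximizes the degree sum among the cliques of maximum size. *)
pose K0 := [arg max_(C > (set0 : {set X}) | clique C) #|C|].
have [cK0 maxK0] : clique K0 /\ forall C : {set X}, clique C -> #|C| <= #|K0|.
  by rewrite /K0; case: arg_maxnP => // C cC maxC; split=> // D /maxC.
pose K := [arg max_(C > K0 | clique C && (#|C| == #|K0|)) weight C].
have [cK cardK maxK] : [/\ clique K, #|K| = #|K0| &
    forall C : {set X}, clique C -> #|C| = #|K0| -> weight C <= weight K].
  rewrite /K; case: arg_maxnP => [|C /andP[cC /eqP cardC] maxC]; first by rewrite cK0 eqxx.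
  by split=> // D cD cardD; apply: maxC; rewrite cD cardD eqxx.
rewrite -cardK in maxK0 maxK.
have cKP := cliqueP _ cK.
have main x y : x \notin K -> y \notin K -> adj x y ->
    {in K, forall u, ~~ adj x u -> ~~ adj y u} ->
    [\/ has_2K2 X, has_C4 X | embeds (cycle_graph 5) X].
  move=> xK yK xy sub_xy.
  (* Otherwise [x] could be added to the maximum clique [K]. *)
  have [u uK nxu] : exists2 u, u \in K & ~~ adj x u.
    apply/exists_inP; rewrite -[X in is_true X]negbK negb_exists_in.
    apply/negP=> /forall_inP xadj.
    have := maxK0 (x |: K); rewrite cardsU1 xK ltnn => /(_ _)/negP[] //.
    by apply: clique_setU1 => // v vK; have := xadj v vK; rewrite negbK.
  have nyu := sub_xy u uK nxu.
  have cKu : clique (K :\ u) by apply: cliqueS cK; apply: subsetDl.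
  case: (boolP [exists u' in K :\ u, ~~ adj x u']).
    move=> /exists_inP[u' /setD1P[u'u u'K] nxu']; constructor 1.
    exists x, y, u, u'; rewrite xy nxu nxu' nyu sub_xy //.
    by rewrite cKP // eq_sym.
  rewrite negb_exists_in => /forall_inP xadj.
  have {}xadj : {in K :\ u, forall v, adj x v} by move=> v /xadj; rewrite negbK.
  have cKx := clique_setU1 cKu xadj.
  have xKu : x \notin K :\ u by rewrite inE (negbTE xK) andbF.
  have cardKx : #|x |: K :\ u| = #|K| by rewrite cardsU1 xKu (cardsD1 u K) uK.
  (* If [y] were adjacent to all of [K :\ u], replacing [u] by both [x] and [y] would give a larger
     clique. *)
  case: (boolP [exists v in K :\ u, ~~ adj y v]); last first.
    rewrite negb_exists_in => /forall_inP yadj.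
    have := maxK0 (y |: (x |: K :\ u)).
    rewrite cardsU1 cardKx !inE eq_sym (negbTE (adj_neq xy)) (negbTE yK) andbF ltnn.
    move=> /(_ _)/negP[] //; apply: clique_setU1 => // v /setU1P[->|/yadj].
      by rewrite adj_sym.
    by rewrite negbK.
  move=> /exists_inP[v vKu nyv]; have xv := xadj v vKu.
  have /setD1P[vu vK] := vKu.
  (* Exchanging [u] for [x] does not increase the degree sum, and [y] is adjacent
     to [x] but not to [u]. *)
  have [w uw nxw] : exists2 w, adj u w & ~~ adj x w.
    have := maxK _ cKx cardKx; rewrite /weight big_setU1 //= (big_setD1 u uK) /=.
    rewrite leq_add2r leqNgt => /negP NuNx; apply/exists_inP.
    rewrite -[X in is_true X]negbK negb_exists_in; apply/negP=> /forall_inP sub_ux.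
    apply/NuNx/proper_card/properP; split.
      by apply/subsetP=> w; rewrite !inE => /sub_ux; rewrite negbK.
    by exists y; rewrite !inE // adj_sym.
  have wx : w != x by apply: contraNneq nxu => <-; rewrite adj_sym.
  have yv : y != v by apply: contraNneq yK => ->.
  have uv : adj u v by rewrite cKP // eq_sym.
  (* The closed walk [w y x v u] decides: without [y w] the edges [x y] and [u w] form [2K_2]; with
     it, [v w] is the chord that yields a 4-cycle, and its absence gives [C_5]. *)
  case: (boolP (adj y w)) => [yw|nyw]; last first.
    by constructor 1; exists x, y, u, w; rewrite xy uw nxu nxw nyu nyw.
  case: (boolP (adj v w)) => [vw|nvw].
    constructor 2; exists w, y, x, v.
    by rewrite (adj_sym w y) yw (adj_sym y x) xy xv (adj_sym w v) vw wx adj_sym nxw yv nyv.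
  constructor 3; apply: (@embeds_cycle5 _ w y x v u) => //; rewrite ?(adj_sym w) //.
  - by rewrite adj_sym.
  - by rewrite adj_sym.
have /not_independent[x [y [xK yK xy]]] : ~~ independent (~: K).
  by apply: contra nsX => iK; apply/existsP; exists (~: K); rewrite iK setCK.
rewrite !inE in xK yK.
case: (boolP [exists u in K, ~~ adj x u && adj y u]); last first.
  rewrite negb_exists_in => /forall_inP sub; apply: (main x y) => // u uK nxu.
  by have := sub u uK; rewrite nxu.
case/exists_inP=> u uK /andP[nxu yu].
case: (boolP [exists v in K, ~~ adj y v && adj x v]); last first.
  rewrite negb_exists_in => /forall_inP sub; apply: (main y x) => //; rewrite 1?adj_sym //.
  by move=> v vK nyv; have := sub v vK; rewrite nyv.
case/exists_inP=> v vK /andP[nyv xv]; constructor 2.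
have uv : u != v by apply: contraNneq nxu => ->.
exists x, y, u, v; rewrite xy yu xv cKP // nxu nyv.
by split; split=> //; [apply: contraNneq xK => -> | apply: contraNneq yK => ->].
Qed.

(** A target graph appears if a vertex is near both edges of the [2K_2] ([common]), if an edge joins
    a vertex near one to a vertex near the other ([link]), or if an edge leads from near [a b] to a
    vertex near neither ([exit]). Otherwise the whole path [p q r] is far from one of the two edges
    and forms [P_3 + K_2] with it. *)
Lemma path3_beside_2K2 (X : sgraph) (p q r : X) :
  adj p q -> adj q r -> p != r -> ~~ adj p r -> has_2K2 X ->
  [\/ embeds (path_graph 3 + complete_graph 2) X, embeds (path_graph 5) X,
      embeds (compl banner) X
    | embeds (compl (complete_graph 1 + cycle_graph 4)) X].
Proof.
move=> pq qr neq_pr npr [a [b [c [d [[ab cd nac nad] [nbc nbd]]]]]].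
set goal := [\/ _, _, _ | _].
pose near1 (u v : X) := (v == u) || adj u v.
pose near (a b v : X) := near1 a v || near1 b v.
pose two (a b c d : X) := [/\ adj a b, adj c d, ~~ adj a c & ~~ adj a d] /\
                          (~~ adj b c /\ ~~ adj b d).
(* These symmetries of [2K_2] allow a vertex near an edge to be taken near its first end. *)
have twoC a' b' c' d' : two a' b' c' d' -> two b' a' c' d'.
  by move=> [[? ? ? ?] [? ?]]; split; split; rewrite // adj_sym.
have twoS a' b' c' d' : two a' b' c' d' -> two c' d' a' b'.
  by move=> [[? ? ? ?] [? ?]]; split; split; rewrite // adj_sym.
have twoC2 a' b' c' d' : two a' b' c' d' -> two a' b' d' c'.
  by move=> T; apply/twoS/twoC/twoS.
have T : two a b c d by [].
(* A vertex near both edges completes a path, a co-banner or a butterfly. *)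
have common1 a' b' c' d' v : two a' b' c' d' -> near1 a' v -> near1 c' v -> goal.
  move=> [[{}ab {}cd {}nac {}nad] [{}nbc {}nbd]].
  case/orP=> [/eqP->|av] /orP[/eqP eq_v|cv].
  - by rewrite eq_v cd in nad.
  - by rewrite adj_sym cv in nac.
  - by rewrite -eq_v av in nac.
  case: (boolP (adj b' v)) => bv; case: (boolP (adj d' v)) => dv.
  - by constructor 4; apply: (@embeds_butterfly _ a' c' b' d' v) => //; rewrite adj_sym.
  - by constructor 3; apply: (@embeds_compl_banner _ d' a' c' b' v) => //; rewrite adj_sym.
  - by constructor 3; apply: (@embeds_compl_banner _ b' c' a' d' v) => //; rewrite adj_sym.
  - by constructor 2; apply: (@embeds_path5 _ b' a' v c' d') => //; rewrite adj_sym.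
have common a' b' c' d' v : two a' b' c' d' -> near a' b' v -> near c' d' v -> goal.
  move=> {}T /orP[av|bv] /orP[cv|dv].
  - exact: common1 T av cv.
  - exact: common1 (twoC2 _ _ _ _ T) av dv.
  - exact: common1 (twoC _ _ _ _ T) bv cv.
  - exact: common1 (twoC2 _ _ _ _ (twoC _ _ _ _ T)) bv dv.
have link1 a' b' c' d' x y : two a' b' c' d' -> near1 a' x -> near1 c' y ->
    adj x y -> goal.
  move=> T' ax cy xy.
  case: (boolP (near c' d' x)) => [|ncdx]; first by apply: (common a' b' _ _ _ T'); rewrite /near ax.
  case: (boolP (near a' b' y)) => [naby|]; first by apply: (common _ _ _ _ _ T' naby); rewrite /near cy.
  case: (T') => [[{}ab {}cd {}nac {}nad] [{}nbc {}nbd]].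
  move: ncdx; rewrite /near /near1 !negb_or => /andP[/andP[xc ncx] /andP[xd ndx]].
  move=> /andP[/andP[ya nay] /andP[yb nby]].
  have {}ax : adj a' x by case/orP: ax => // /eqP eq_x; rewrite -eq_x xy in nay.
  have {}cy : adj c' y by case/orP: cy => // /eqP eq_y; rewrite -eq_y adj_sym xy in ncx.
  (* Either [a' b' x] is a triangle with the path [x y c'] attached, a co-banner, or [b' a' x] is an
     induced path far from the edge [c' d']. *)
  case: (boolP (adj b' x)) => [bx|nbx].
    by constructor 3; apply: (@embeds_compl_banner _ c' a' y b' x) => //; rewrite adj_sym.
  constructor 1; apply: (@embeds_path3_edge _ b' a' x c' d') => //; rewrite 1?adj_sym //.
  by apply: contraNneq nby => ->.
have link a' b' c' d' x y : two a' b' c' d' -> near a' b' x -> near c' d' y ->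
    adj x y -> goal.
  move=> {}T /orP[ax|bx] /orP[cy|dy].
  - exact: link1 T ax cy.
  - exact: link1 (twoC2 _ _ _ _ T) ax dy.
  - exact: link1 (twoC _ _ _ _ T) bx cy.
  - exact: link1 (twoC2 _ _ _ _ (twoC _ _ _ _ T)) bx dy.
have exit1 a' b' c' d' x y : two a' b' c' d' -> near1 a' x -> adj x y ->
    ~~ near a' b' y -> ~~ near c' d' y -> goal.
  move=> T' ax xy naby ncdy.
  case: (boolP (near c' d' x)) => [|ncdx]; first by apply: (common a' b' _ _ _ T'); rewrite /near ax.
  case: (T') => [[{}ab {}cd {}nac {}nad] [{}nbc {}nbd]].
  move: ncdx naby ncdy; rewrite /near /near1 !negb_or => /andP[/andP[xc ncx] /andP[xd ndx]].
  move=> /andP[/andP[ya nay] /andP[yb nby]] /andP[/andP[yc ncy] /andP[yd ndy]].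
  have {}ax : adj a' x by case/orP: ax => // /eqP eq_x; rewrite -eq_x xy in nay.
  (* Both [x] and [y] are far from [c' d'], so the path [a' x y] lies apart from that edge. *)
  by constructor 1; apply: (@embeds_path3_edge _ a' x y c' d') => //;
    first [by rewrite eq_sym | by rewrite adj_sym].
have exit x y : near a b x -> adj x y -> ~~ near a b y -> ~~ near c d y -> goal.
  move=> /orP[ax|bx] xy naby ncdy; first exact: exit1 T ax xy naby ncdy.
  by apply: (exit1 _ _ _ _ x y (twoC _ _ _ _ T)) => //; rewrite /near orbC.
have qp : adj q p by rewrite adj_sym.
have rq : adj r q by rewrite adj_sym.
have far u : ~~ near a b u -> ~~ adj u a && ~~ adj u b.
  by rewrite /near /near1 !negb_or !(adj_sym u) => /andP[/andP[_ ->] /andP[_ ->]].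
have far' u : ~~ near c d u -> ~~ adj u c && ~~ adj u d.
  by rewrite /near /near1 !negb_or !(adj_sym u) => /andP[/andP[_ ->] /andP[_ ->]].
case: (boolP (near a b q)) => [aq|naq].
  case: (boolP (near c d q)) => [|/far'/andP[? ?]]; first exact: common T aq.
  case: (boolP (near c d p)) => [cp|/far'/andP[? ?]]; first exact: link T aq cp qp.
  case: (boolP (near c d r)) => [cr|/far'/andP[? ?]]; first exact: link T aq cr qr.
  by constructor 1; apply: (@embeds_path3_edge _ p q r c d).
case: (boolP (near a b p)) => [ap|nap].
  case: (boolP (near c d q)) => [cq|ncq]; first exact: link T ap cq pq.
  exact: exit ap pq naq ncq.
case: (boolP (near a b r)) => [ar|nar].
  case: (boolP (near c d q)) => [cq|ncq]; first exact: link T ar cq rq.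
  exact: exit ar rq naq ncq.
have [/andP[? ?] /andP[? ?] /andP[? ?]] := And3 (far _ nap) (far _ naq) (far _ nar).
by constructor 1; apply: (@embeds_path3_edge _ p q r a b).
Qed.

(** * Disconnected graphs that are not polar *)

Lemma disconnected_separated (G : sgraph) :
  ~ connected G ->
  exists A : {set G}, [/\ separated A (~: A), A != set0 & ~: A != set0].
Proof.
move=> dG.
have /forallPn[x /forallPn[y nxy]] : ~~ [forall x, forall y, connect (@adj G) x y].
  by apply/negP=> /'forall_forallP cG; apply: dG.
exists [set z | connect (@adj G) x z]; split.
- move=> z w; rewrite !inE => xz xw; apply/andP; split.
    by apply: contraNneq xw => <-.
  by apply: contra xw => zw; apply: connect_trans xz (connect1 zw).
- by apply/set0Pn; exists x; rewrite inE connect0.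
- by apply/set0Pn; exists y; rewrite !inE.
Qed.

Lemma clique_multipartite (X : sgraph) (A : {set X}) : clique A -> multipartite A.
Proof.
move=> /cliqueP cA; apply/multipartiteP=> x y z xA yA zA xz.
by case: (eqVneq x y) => [<-|neq]; rewrite ?xz ?orbT // cA.
Qed.

Lemma independent_multipartite (X : sgraph) (A : {set X}) :
  independent A -> multipartite A.
Proof.
move=> /independentP iA; apply/multipartiteP=> x y z xA _ zA xz.
by have := iA x z xA zA; rewrite xz.
Qed.

Lemma independent_clique_free (X : sgraph) (A : {set X}) :
  independent A -> clique_free 2 A.
Proof.
move=> /independentP iA; apply/clique_freeP=> C /subsetP CA /cliqueP cC.
rewrite ltnS; apply/card_le1_eqP=> x y xC yC; apply/eqP/negPn/negP=> neq.
by have := iA y x (CA y yC) (CA x xC); rewrite cC.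
Qed.

Lemma clique_freeW (X : sgraph) (j k : nat) (A : {set X}) :
  j <= k -> clique_free j A -> clique_free k A.
Proof.
by move=> jk /clique_freeP fA; apply/clique_freeP=> C CA cC; apply: leq_trans jk; apply: fA.
Qed.

(** Every vertex of [A] is adjacent to an end of the edge [a b], and non-adjacent vertices have the
    same neighbours in [A]. So a non-adjacent pair has a common neighbour. *)
Lemma multipartite_path3 (X : sgraph) (A : {set X}) :
  multipartite A -> ~~ independent A -> ~~ clique A -> embeds_in (path_graph 3) A.
Proof.
move=> /multipartiteP mA /not_independent[a [b [aA bA ab]]].
move=> /not_clique[x [y [xA yA neq nxy]]].
have [w wA xw] : exists2 w, w \in A & adj x w.
  by case/orP: (mA a x b aA xA bA ab) => xw; [exists a | exists b]; rewrite // adj_sym.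
have := mA x y w xA yA wA xw; rewrite (negbTE nxy) /= => yw.
by apply: (@embeds_path3 _ _ x w y); rewrite // adj_sym.
Qed.

(** Two vertices of [C] not adjacent to [x] would lie in the part of [x], although they are
    adjacent. So [x] misses at most one vertex of [C], possibly itself. *)
Lemma multipartite_clique_nbrs (X : sgraph) (A C : {set X}) (x : X) :
  multipartite A -> clique C -> C \subset A -> x \in A ->
  #|C| <= #|[set c in C | adj x c]|.+1.
Proof.
move=> /multipartiteP mA /cliqueP cC /subsetP CA xA.
rewrite -(cardsID [set c | adj x c] C) -addn1 -setIdE leq_add2l.
apply/card_le1_eqP=> c d /setDP[cC' nxc] /setDP[dC' nxd].
apply/eqP/negPn/negP=> neq; rewrite !inE in nxc nxd.
have := mA d x c (CA d dC') xA (CA c cC') (cC d c dC' cC' neq).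
by rewrite adj_sym (negbTE nxc) (negbTE nxd).
Qed.

(** As [A] could serve as the clique, [~: A] must contain a clique [C] of size [s + 1]. If [~: A] is
    a clique, exchanging the roles gives the second [K_(s+1)]. If not, non-adjacent [x] and [y]
    there have the same neighbours, among them at least [s] vertices of [C]. *)
Lemma embeds_clique_side (s : nat) (G : sgraph) (A : {set G}) :
  separated A (~: A) -> ~~ independent A -> ~~ polar1 s G ->
  clique A -> multipartite (~: A) ->
  embeds (copies 2 (complete_graph s.+1)) G \/
  embeds (complete_graph 2 + (copies 2 (complete_graph 1) ⊕ complete_graph s)) G.
Proof.
move=> sA iA npG cA mA'.
have /not_clique_free[C [CA' cC sC]] : ~~ clique_free s.+1 (~: A).
  by apply: contra npG => fA'; apply/existsP; exists (~: A); rewrite mA' fA' setCK.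
case: (boolP (clique (~: A))) => [cA'|/not_clique[x [y [xA yA neq nxy]]]].
  have /not_clique_free[D [DA cD sD]] : ~~ clique_free s.+1 A.
    apply: contra npG => fA; apply/existsP; exists A.
    by rewrite (clique_multipartite cA) fA.
  left; apply: (embeds_copies2 sA); last exact: embeds_inS CA' (embeds_complete cC sC).
  exact: embeds_inS DA (embeds_complete cD sD).
right; have /not_independent[a [b [aA bA ab]]] := iA.
apply: (embeds_disj_union sA); first exact: embeds_complete2 aA bA ab.
apply: (@embeds_join _ _ _ [set x; y] [set c in C | adj x c]).
- move=> v c /set2P[]->; rewrite inE => /andP[cC' xc] //.
  have := multipartiteP _ mA' x y c xA yA (subsetP CA' c cC') xc.
  by rewrite (negbTE nxy).
- by rewrite subUset !sub1set xA.
- by apply: subset_trans CA'; apply/subsetP=> c; rewrite inE => /andP[].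
- by apply: (@embeds_copies2_complete1 _ _ x y); rewrite // !inE eqxx ?orbT.
- apply: embeds_complete; last first.
    by rewrite -ltnS; apply: leq_trans sC (multipartite_clique_nbrs mA' cC CA' xA).
  by apply: cliqueS cC; apply/subsetP=> c; rewrite inE => /andP[].
Qed.

(** The failure of transitivity gives an edge [x z] and a vertex [y] off it; the edge [c d] comes
    from the other side. *)
Lemma embeds_not_multipartite_side (G : sgraph) (A : {set G}) :
  separated A (~: A) -> ~~ independent (~: A) -> ~~ multipartite A ->
  embeds (complete_graph 1 + copies 2 (complete_graph 2)) G.
Proof.
move=> sA /not_independent[c [d [cA dA cd]]].
move=> /not_multipartite[x [y [z [[xA yA zA] [xz nxy nyz]]]]].
have nadj a b : a \in A -> b \in ~: A -> ~~ adj a b by move=> aA bA; case/andP: (sA a b aA bA).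
by apply: (@embeds_edge_plus _ x z c d y) => //;
  first [exact: nadj | rewrite adj_sym; first [exact: nadj | by []]].
Qed.

Lemma embeds_two_sides (s : nat) (G : sgraph) (A : {set G}) :
  separated A (~: A) -> ~~ independent A -> ~~ independent (~: A) ->
  ~~ polar1 s G ->
  [\/ embeds (complete_graph 1 + copies 2 (complete_graph 2)) G,
      embeds (copies 2 (path_graph 3)) G,
      embeds (copies 2 (complete_graph s.+1)) G
    | embeds (complete_graph 2 + (copies 2 (complete_graph 1) ⊕ complete_graph s)) G].
Proof.
move=> sA iA iA' npG.
have sA' : separated (~: A) (~: ~: A) by rewrite setCK; apply: separatedC.
case: (boolP (multipartite A)) => [mA|nmA]; last first.
  by constructor 1; apply: embeds_not_multipartite_side nmA.
case: (boolP (multipartite (~: A))) => [mA'|nmA']; last first.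
  by constructor 1; apply: (embeds_not_multipartite_side sA' _ nmA'); rewrite setCK.
case: (boolP (clique A)) => [cA|ncA].
  by case: (embeds_clique_side sA iA npG cA mA'); [constructor 3 | constructor 4].
case: (boolP (clique (~: A))) => [cA'|ncA'].
  have mA2 : multipartite (~: ~: A) by rewrite setCK.
  by case: (embeds_clique_side sA' iA' npG cA' mA2); [constructor 3 | constructor 4].
constructor 2; apply: (embeds_copies2 sA); exact: multipartite_path3.
Qed.

(** Adding [u] to the independent part of a split partition keeps it independent, hence multipartite
    with at most one part, which [0 < s] allows. *)
Lemma not_split_delete_isolated (s : nat) (G : sgraph) (u : G) :
  0 < s -> isolated u -> ~~ polar1 s G -> ~~ split_graph (induced [set~ u]).
Proof.
move=> s0 /isolatedP iu; apply: contra => /existsP[A /andP[/independentP iA /cliqueP cA]].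
(* As the complement of the clique in [G], this set contains [u]. *)
pose B := ~: [set val x | x in ~: A].
have iB : independent B.
  apply/independentP=> x y; rewrite !inE => xB yB; apply/negP=> xy.
  have xu : x \in [set~ u] by rewrite !inE; apply: contraTneq xy => ->; rewrite iu.
  have yu : y \in [set~ u] by rewrite !inE; apply: contraTneq xy => ->; rewrite adj_sym iu.
  have xA : exist _ x xu \in A.
    by apply: contraNT xB => xA; apply/imsetP; exists (exist _ x xu); rewrite ?inE.
  have yA : exist _ y yu \in A.
    by apply: contraNT yB => yA; apply/imsetP; exists (exist _ y yu); rewrite ?inE.
  by have := iA _ _ xA yA; rewrite /= /induced_adj /= xy.
apply/existsP; exists B; rewrite independent_multipartite //=.
rewrite (@clique_freeW _ 2) //= ?independent_clique_free // setCK.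
apply/cliqueP=> _ _ /imsetP[x xA ->] /imsetP[y yA ->] neq.
by apply: cA; rewrite // -val_eqE.
Qed.

(** Opposite vertices of the 4-cycle lie in the same part, so a vertex adjacent to [a] and [b] is
    adjacent to all four. Of the [s + 1] vertices of a clique, [a] and [b] each exclude at most one,
    leaving [s - 1]. *)
Lemma embeds_isolated_multipartite (s : nat) (G : sgraph) (u : G) :
  isolated u -> multipartite [set~ u] -> ~~ clique_free s.+1 [set~ u] ->
  has_C4 (induced [set~ u]) ->
  embeds (complete_graph 1 + (cycle_graph 4 ⊕ complete_graph (s - 1))) G.
Proof.
move=> iu mH /not_clique_free[C [CH cC sC]].
move=> [[a aH] [[b bH] [[c cH] [[d dH]]]]].
rewrite -2!val_eqE /= /induced_adj /= => -[[ab bc cd ad] [neq_ac nac neq_bd nbd]].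
apply: (embeds_isolated iu).
pose Ca := [set x in C | adj a x]; pose Cab := [set x in Ca | adj b x].
have CaC : Ca \subset C by apply/subsetP=> x; rewrite inE => /andP[].
have CabCa : Cab \subset Ca by apply/subsetP=> x; rewrite inE => /andP[].
have cCa := cliqueS CaC cC; have CaH := subset_trans CaC CH.
apply: (@embeds_join _ _ _ [set a; b; c; d] Cab).
- move=> v x vC; rewrite !inE => /andP[/andP[xC ax] bx].
  have xH := subsetP CH x xC.
  have := multipartiteP _ mH a c x aH cH xH ax; rewrite (negbTE nac) /= => cx.
  have := multipartiteP _ mH b d x bH dH xH bx; rewrite (negbTE nbd) /= => dx.
  by move: vC; rewrite !inE -!orbA => /or4P[] /eqP->.
- by rewrite !subUset !sub1set aH bH cH dH.
- exact: subset_trans CabCa CaH.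
- by apply: (@embeds_cycle4 _ _ a b c d); rewrite // !inE eqxx ?orbT.
apply: embeds_complete; first exact: cliqueS CabCa cCa.
rewrite leq_subLR add1n -ltnS; apply: leq_trans sC _.
apply: leq_trans (multipartite_clique_nbrs mH cC CH aH) _; rewrite ltnS.
exact: multipartite_clique_nbrs mH cCa CaH bH.
Qed.

Lemma embeds_isolated_not_multipartite (G : sgraph) (u : G) :
  isolated u -> ~~ multipartite [set~ u] -> has_C4 (induced [set~ u]) ->
  [\/ embeds (complete_graph 1 + compl (path_graph 3 + complete_graph 2)) G,
      embeds (complete_graph 1 + compl (path_graph 5)) G,
      embeds (complete_graph 1 + banner) G
    | embeds (copies 2 (complete_graph 1) + cycle_graph 4) G].
Proof.
move=> iu /not_multipartite[x [y [z [[xH yH zH] [xz nxy nyz]]]]] C4.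
set H := induced [set~ u] in C4.
have inH L : embeds L H -> embeds_in L [set~ u].
  by move=> LH; apply: embeds_in_trans LH (embeds_induced _).
have isoH L : embeds L H -> embeds (complete_graph 1 + L) G.
  by move=> LH; apply: (embeds_isolated iu); apply: inH.
pose x' : H := exist _ x xH; pose y' : H := exist _ y yH; pose z' : H := exist _ z zH.
have xz' : x' != z' by rewrite -val_eqE /= adj_neq.
have xy' : x' != y' by rewrite -val_eqE /=; apply: contraNneq nyz => <-.
have yz' : y' != z' by rewrite -val_eqE /=; apply: contraNneq nxy => ->.
(* The diagonals [a c] and [b d] of the 4-cycle are the two edges in the complement. *)
have K2 : has_2K2 (compl H).
  case: C4 => a [b [c [d [[ab bc cd ad] [neq_ac nac neq_bd nbd]]]]].
  exists a, c, b, d; rewrite /= /compl_adj ab ad (adj_sym c b) bc cd !andbF.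
  by rewrite neq_ac nac neq_bd nbd.
case: (@path3_beside_2K2 (compl H) x' y' z' _ _ xz' _ K2).
- by rewrite /= /compl_adj xy'.
- by rewrite /= /compl_adj yz'.
- by rewrite /= /compl_adj /= /induced_adj /= xz andbF.
(* The first two graphs are complemented on the way back to [H]; the last two are already written as
   complements, so both complements cancel. *)
- by move/embeds_compl/isoH; constructor 1.
- by move/embeds_compl/isoH; constructor 2.
- by move/embeds_of_compl/isoH; constructor 3.
- by move/embeds_of_compl/inH/(embeds_two_isolated iu); constructor 4.
Qed.

Lemma embeds_isolated_cases (s : nat) (G : sgraph) (u : G) :
  0 < s -> isolated u -> ~~ polar1 s G ->
  [\/ (embeds (complete_graph 1 + copies 2 (complete_graph 2)) G
       \/ embeds (copies 2 (complete_graph 1) + cycle_graph 4) G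
       \/ embeds (complete_graph 1 + cycle_graph 5) G),
      (embeds (complete_graph 1 + compl (path_graph 3 + complete_graph 2)) G
       \/ embeds (complete_graph 1 + compl (path_graph 5)) G),
      embeds (complete_graph 1 + banner) G
    | embeds (complete_graph 1 + (cycle_graph 4 ⊕ complete_graph (s - 1))) G].
Proof.
move=> s0 iu npG; have iu' := isolatedP _ iu.
case: (foldes_hammer (not_split_delete_isolated s0 iu npG)) => [|C4|C5].
- move=> [a [b [c [d [[ab cd nac nad] [nbc nbd]]]]]]; constructor 1; left.
  by apply: (@embeds_edge_plus _ (val a) (val b) (val c) (val d) u); rewrite // adj_sym iu'.
- case: (boolP (multipartite [set~ u])) => [mH|nmH]; last first.
    case: (embeds_isolated_not_multipartite iu nmH C4) => ?.
    + by constructor 2; left.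
    + by constructor 2; right.
    + by constructor 3.
    + by constructor 1; right; left.
  constructor 4; apply: (embeds_isolated_multipartite iu mH _ C4).
  apply: contra npG => fH; apply/existsP; exists [set~ u]; rewrite mH fH setCK /=.
  by apply/cliqueP=> x y /set1P-> /set1P->; rewrite eqxx.
constructor 1; do 2!right; apply: (embeds_isolated iu).
exact: embeds_in_trans C5 (embeds_induced _).
Qed.

Lemma separated_isolated (G : sgraph) (A : {set G}) (u : G) :
  separated A (~: A) -> independent A -> u \in A -> isolated u.
Proof.
move=> sA /independentP iA uA; apply/isolatedP=> x; apply/negbTE.
case: (boolP (x \in A)) => [|xA]; first exact: iA.
have xA' : x \in ~: A by rewrite inE.
by case/andP: (sA u x uA xA').
Qed.

Theorem theorem29 (s : nat) (hs : 2 <= s) (G : sgraph)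
  (G_disconnected : ~ connected G)
  (G_obstruction : minimal_polar_obstruction s 1 G) :
  [\/ (G ≅ complete_graph 1 + copies 2 (complete_graph 2)
       \/ G ≅ copies 2 (path_graph 3)
       \/ G ≅ copies 2 (complete_graph 1) + cycle_graph 4
       \/ G ≅ complete_graph 1 + compl (path_graph 3 + complete_graph 2)
       \/ G ≅ complete_graph 1 + cycle_graph 5
       \/ G ≅ complete_graph 1 + banner
       \/ G ≅ complete_graph 1 + compl (path_graph 5)),
      G ≅ copies 2 (complete_graph s.+1),
      G ≅ complete_graph 2 + (copies 2 (complete_graph 1) ⊕ complete_graph s)
    | G ≅ complete_graph 1 + (cycle_graph 4 ⊕ complete_graph (s - 1))].
Proof.
have s0 : 0 < s := ltnW hs.
have iso L := @minimal_obstruction_embeds s L G G_obstruction.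
have npG : ~~ polar1 s G by apply/polar1P; case: G_obstruction.
have [A [sA /set0Pn[a aA] /set0Pn[b bA]]] := disconnected_separated G_disconnected.
have sA' : separated (~: A) (~: ~: A) by rewrite setCK; apply: separatedC.
(* A side without edges consists of isolated vertices of [G]. *)
have [[u iu]|[iA iA']] :
    (exists u : G, isolated u) \/ (~~ independent A /\ ~~ independent (~: A)).
  case: (boolP (independent A)) => iA.
    by left; exists a; apply: separated_isolated aA.
  case: (boolP (independent (~: A))) => iA'; last by right.
  by left; exists b; apply: separated_isolated bA.
- case: (embeds_isolated_cases s0 iu npG) => [[|[|]]|[|]||] /iso isoL.
  + by constructor 1; left; apply/isoL/not_polar1_2K2.
  + by constructor 1; do 2!right; left; apply/isoL/not_polar1_2K1_C4.
  + by constructor 1; do 4!right; left; apply/isoL/not_polar1_C5.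
  + by constructor 1; do 3!right; left; apply/isoL/not_polar1_co_P3_K2.
  + by constructor 1; do 6!right; apply/isoL/not_polar1_co_P5.
  + by constructor 1; do 5!right; left; apply/isoL/not_polar1_banner.
  + by constructor 4; apply/isoL/not_polar1_C4_join.
- case: (embeds_two_sides sA iA iA' npG) => /iso isoL.
  + by constructor 1; left; apply/isoL/not_polar1_2K2.
  + by constructor 1; right; left; apply/isoL/not_polar1_2P3.
  + by constructor 2; apply/isoL/not_polar1_2K.
  + by constructor 3; apply/isoL/not_polar1_K2_join.
Qed.
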